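(* Let $A$ be a unital $C^*$-algebra. The relation $\leq_\diamond$ is a partial order on $A$ (that is, it is reflexive, antisymmetric and transitive).
   Context: For elements $a,b$ of a unital $C^*$-algebra $A$, the diamond relation is defined by: $a\leq_\diamond b$ if and only if $aA\subseteq bA$, $Aa\subseteq Ab$ and $aa^*a=ab^*a$. *)

(* Defs.v *)
From HB Require Import structures.
From mathcomp Require Import all_boot all_order all_algebra.
From mathcomp Require Import complex.
From mathcomp Require Import classical_sets reals topology normedtype.

Set Implicit Arguments.
Unset Strict Implicit.
Unset Printing Implicit Defensive.

Import Order.TTheory GRing.Theory Num.Theory.
Import numFieldNormedType.Exports.

Local Open Scope classical_set_scope.
Local Open Scope ring_scope.

(* Unital complex C*-algebras over R[i], with R a realType. The norm of a      *)
(* normed module over R[i] is R[i]-valued (its values are nonnegative, hence   *)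
(* real). The axiom 1 != 0 is not required, so the zero algebra is included.   *)
(* The ring operations are part of the mixin because Hierarchy Builder rejects *)
(* a join of ring and normed-module structures that is not below numDomainType *)
(* ("missing join"); the pzRingType structure is derived just after.           *)
HB.mixin Record isCStarAlgebra (R : realType) A
    of CompleteNormedModule R[i] A := {
  cstar_one : A;
  cstar_mul : A -> A -> A;
  star : A -> A;
  cstar_mulA : associative cstar_mul;
  cstar_mul1r : left_id cstar_one cstar_mul;
  cstar_mulr1 : right_id cstar_one cstar_mul;
  cstar_mulDl : left_distributive cstar_mul +%R;
  cstar_mulDr : right_distributive cstar_mul +%R;
  cstar_scaleAl : forall (k : R[i]) (x y : A),
    k *: cstar_mul x y = cstar_mul (k *: x) y;
  cstar_scaleAr : forall (k : R[i]) (x y : A),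
    k *: cstar_mul x y = cstar_mul x (k *: y);
  cstar_normM : forall x y : A, `|cstar_mul x y| <= `|x| * `|y|;
  starK : involutive star;
  starD : {morph star : x y / x + y};
  starZ : forall (k : R[i]) (x : A), star (k *: x) = k^* *: star x;
  starM : forall x y : A, star (cstar_mul x y) = cstar_mul (star y) (star x);
  cstar_norm : forall x : A, `|cstar_mul (star x) x| = `|x| ^+ 2;
}.

#[short(type="cstarAlgType")]
HB.structure Definition CStarAlgebra (R : realType) :=
  {A of CompleteNormedModule R[i] A & isCStarAlgebra R A}.

HB.instance Definition _ (R : realType) (A : cstarAlgType R) :=
  GRing.Zmodule_isPzRing.Build A (@cstar_mulA R A) (@cstar_mul1r R A)
    (@cstar_mulr1 R A) (@cstar_mulDl R A) (@cstar_mulDr R A).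

Definition principal_right_ideal (A : pzRingType) (a : A) : set A :=
  [set a * x | x in [set: A]].

Definition principal_left_ideal (A : pzRingType) (a : A) : set A :=
  [set x * a | x in [set: A]].

Definition diamond_le (R : realType) (A : cstarAlgType R) (a b : A) : Prop :=
  [/\ principal_right_ideal a `<=` principal_right_ideal b,
      principal_left_ideal a `<=` principal_left_ideal b &
      a * star a * a = a * star b * a].

(* Main.v *)
Require Import Defs.
From mathcomp Require Import all_boot all_algebra reals.
From Stdlib Require Relation_Definitions.

(* Transitivity: writing a = y b = b x, one has a c^* a = y (b c^* b) x. For
   antisymmetry, put c = a - b. The ideals of a and b coincide, so
   a c^* a = 0 = b c^* b also yields a c^* b = 0 = b c^* a. Hence c c^* c = 0,
   and c = 0 by two applications of the C^*-identity. *)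

Import GRing.Theory Num.Theory.
Local Open Scope ring_scope.

Section CStarAlgebraTheory.
Variables (R : realType) (A : cstarAlgType R).
Implicit Types a b c : A.

Lemma starB a b : star (a - b) = star a - star b.
Proof. by apply: (addIr (star b)); rewrite -starD !subrK. Qed.

Lemma star_mul_eq0 a : star a * a = 0 -> a = 0.
Proof.
move=> a0; have := cstar_norm a; rewrite [cstar_mul _ _]a0 normr0.
by move/esym/eqP; rewrite expf_eq0 /= normr_eq0 => /eqP.
Qed.

(** The element [star a * a] is self-adjoint and its square is [star a * (a * star a * a)]. *)
Lemma mul_star_mul_eq0 a : a * star a * a = 0 -> a = 0.
Proof.
move=> a0; apply/star_mul_eq0/star_mul_eq0.
have -> : star (star a * a) = star a * a by rewrite [LHS]starM starK.
by rewrite -mulrA (mulrA a) a0 mulr0.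
Qed.

(** As [A] has a unit, a principal ideal lies in another as soon as its generator does. *)
Lemma diamond_leP a b : diamond_le a b <->
  [/\ exists x, a = b * x, exists y, a = y * b &
      a * star a * a = a * star b * a].
Proof.
split=> [[ra la e]|[[x ax] [y ay] e]]; split=> //.
- by have [|x _ <-] := ra a; [exists 1; rewrite ?mulr1 | exists x].
- by have [|y _ <-] := la a; [exists 1; rewrite ?mul1r | exists y].
- by move=> _ [z _ <-]; exists (x * z) => //; rewrite mulrA -ax.
- by move=> _ [z _ <-]; exists (z * y) => //; rewrite -mulrA -ay.
Qed.

Lemma diamond_le_refl a : diamond_le a a.
Proof. by split. Qed.

Lemma diamond_le_trans a b c :
  diamond_le a b -> diamond_le b c -> diamond_le a c.
Proof.
move=> /diamond_leP[[x ax] [y ay] eab] /diamond_leP[[u bu] [v bv] ebc].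
apply/diamond_leP; split.
- by exists (u * x); rewrite mulrA -bu.
- by exists (y * v); rewrite -mulrA -bv.
(* Applied with [d] equal to [star b] and to [star c], the two middle factors being equal by
   [ebc]. *)
have sandwich d : a * d * a = y * (b * d * b) * x.
  by rewrite {1}ay ax !mulrA.
by rewrite eab !sandwich ebc.
Qed.

Lemma diamond_le_anti a b : diamond_le a b -> diamond_le b a -> a = b.
Proof.
move=> /diamond_leP[_ _ eab] /diamond_leP[[u bu] [v bv] eba].
apply/eqP; rewrite -subr_eq0; apply/eqP/mul_star_mul_eq0.
set d := star (a - b).
have ada : a * d * a = 0 by rewrite /d starB mulrBr mulrBl eab subrr.
(* Since [b = a * u = v * a], the vanishing of [a * d * a] spreads to the other three terms of
   [(a - b) * d * (a - b)]. *)
have adb : a * d * b = 0 by rewrite bu mulrA ada mul0r.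
have bda : b * d * a = 0 by rewrite bv -!mulrA (mulrA a) ada mulr0.
have bdb : b * d * b = 0 by rewrite {2}bu mulrA bda mul0r.
by rewrite mulrBr !mulrBl ada adb bda bdb !subrr.
Qed.

End CStarAlgebraTheory.

Theorem proposition2p3 (R : realType) (A : cstarAlgType R) :
  Relation_Definitions.order A (@diamond_le R A).
Proof.
split; [exact: diamond_le_refl | exact: diamond_le_trans |].
exact: diamond_le_anti.
Qed.
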